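(* Let $G=(V,E)$ be a simple undirected graph with $V=[n]$, $N=\binom n2$, $\mathcal P_n=\{(i,j):i<j\}$ enumerated as $(i_k,j_k)$, $k\in[N]$, $\sigma^*$ a permutation of $[n]$ and $y_k=\operatorname{sign}(\sigma^*(i_k)-\sigma^*(j_k))$. Let $U=[u_1,\dots,u_n]\in\mathrm{Lab}(G)$, $K=U^\top U$, and let $\tilde U\in\mathbb R^{d^2\times N}$ have columns $\tilde u_k=u_{i_k}\otimes u_{j_k}$. Fix $C>0$, $f\in(0,1/2]$, $m=\lceil Nf\rceil$, let $S\subseteq\mathcal P_n$ with $|S|=m$ be drawn uniformly at random with labels revealed, $\bar S=\mathcal P_n\setminus S$, and let $\ell^\rho:\{\pm1\}\times\mathbb R\to[0,B]$ be a bounded loss, $\rho$-Lipschitz in its second argument ($|\ell^\rho(y,a)-\ell^\rho(y,a')|\le\frac1\rho|a-a'|$). Let $f^*=\tilde U^\top w^*$ be the score vector output by Pref-Rank on $(\tilde U,S,\{y_k\}_{k\in S})$. Then there is a constant $C_1>0$ such that for any $\delta>0$, with probability at least $1-\delta$ over $S$, $$er^{\ell^\rho}_{\bar S}(f^* )\le er^{\ell^\rho}_S(f^* )+\frac{C\lambda_1(K)\sqrt2}{\rho\sqrt{f(1-f)}}+\frac{C_1B}{1-f}\sqrt{\frac{\log(1/\delta)}{Nf}}.$$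
   Context: $\mathrm{Lab}(G)$: matrices $U=[u_1,\dots,u_n]\in\mathbb R^{d\times n}$ with unit columns and $u_i^\top u_j=0$ whenever $i\ne j$, $(i,j)\notin E$. $\lambda_1(K)$ is the largest eigenvalue of $K$. Pref-Rank with embedding $\tilde U$ and parameter $C$: $w^*\in\arg\min_w\frac12\|w\|_2^2+C\sum_{k\in S}\max(0,1-y_kw^\top\tilde u_k)$, output $f^*=\tilde U^\top w^*$. $er^\ell_S(g)=\frac1{|S|}\sum_{k\in S}\ell(y_k,g_k)$, $er^\ell_{\bar S}(g)=\frac1{|\bar S|}\sum_{k\in\bar S}\ell(y_k,g_k)$. *)

(* Defs.v *)
From HB Require Import structures.
From mathcomp Require Import all_boot all_order all_algebra all_fingroup.
From mathcomp Require Import mxtens.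
From mathcomp Require Import boolp reals exp.
Set Implicit Arguments. Unset Strict Implicit. Unset Printing Implicit Defensive.
Import Order.TTheory GRing.Theory Num.Theory.
Local Open Scope ring_scope.

Definition pairs (n : nat) := {p : 'I_n * 'I_n | (p.1 < p.2)%N}.

Section Defs.
Variable R : realType.

Definition simple_graph n (e : rel 'I_n) : Prop :=
  symmetric e /\ irreflexive e.

Definition in_Lab n d (e : rel 'I_n) (U : 'M[R]_(d, n)) : Prop :=
  (forall i : 'I_n, \sum_(a < d) U a i ^+ 2 = 1) /\
  (forall i j : 'I_n, i != j -> ~~ e i j -> \sum_(a < d) U a i * U a j = 0).

Definition is_lambda1 n (K : 'M[R]_n) (lam : R) : Prop :=
  eigenvalue K lam /\ (forall a, eigenvalue K a -> a <= lam).

Definition ylab n (sigma : 'S_n) (k : pairs n) : R :=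
  Num.sg ((sigma (val k).1)%:R - (sigma (val k).2)%:R : R).

Definition utilde n d (U : 'M[R]_(d, n)) (k : pairs n) : 'M[R]_(d * d, 1 * 1) :=
  col (val k).1 U *t col (val k).2 U.

Definition dotv D (w : 'M[R]_(D, 1)) (x : 'M[R]_(D, 1 * 1)) : R :=
  \sum_(a < D) w a ord0 * x a (cast_ord (esym (muln1 1)) ord0).

Definition scores n d (U : 'M[R]_(d, n)) (w : 'M[R]_(d * d, 1)) (k : pairs n) : R :=
  dotv w (utilde U k).

Definition prefrank_obj n d (U : 'M[R]_(d, n)) (sigma : 'S_n) (C : R)
    (S : {set pairs n}) (w : 'M[R]_(d * d, 1)) : R :=
  2^-1 * \sum_(a < d * d) w a ord0 ^+ 2
  + C * \sum_(k in S) Num.max 0 (1 - ylab sigma k * scores U w k).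

Definition is_prefrank_sol n d (U : 'M[R]_(d, n)) (sigma : 'S_n) (C : R)
    (S : {set pairs n}) (w : 'M[R]_(d * d, 1)) : Prop :=
  forall w', prefrank_obj U sigma C S w <= prefrank_obj U sigma C S w'.

Definition er n (l : R -> R -> R) (y : pairs n -> R) (g : pairs n -> R)
    (A : {set pairs n}) : R :=
  (#|A|%:R)^-1 * \sum_(k in A) l (y k) (g k).

Definition prob_subset n (m : nat) (E : {set pairs n} -> Prop) : R :=
  (#|[set S : {set pairs n} | (#|S| == m) && `[< E S >]]|%:R) /
  (#|[set S : {set pairs n} | #|S| == m]|%:R).
End Defs.

(* Main.v *)
(** A Pref-Rank solution w satisfies |w|^2 <= C sum_S |w.u_k| by first-order
    optimality, and sum_k (w.u_k)^2 <= lambda_1(K)^2 |w|^2 because the features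
    are columns of U (x) U; hence |w| <= C lambda_1 sqrt m.  The largest gap
    er_(~:S) - er_S over such w has mean at most 2/p times the Rademacher
    complexity of p = min(m, N - m) points: the gap is an average, over
    permutations stabilising S, of paired differences over p points inside and
    p points outside S, and a random permutation may be composed with the
    transposition of any pair.  Contraction bounds that complexity by
    C lambda_1 sqrt(m p) / rho.  Swapping one point of S moves the gap by at most
    B (1/m + 1/(N - m)), so the Chernoff bound for sampling without replacement
    gives the last term, with no additive term independent of delta. *)
Require Import Defs.
From HB Require Import structures.
From mathcomp Require Import all_boot all_order all_algebra all_fingroup.
From mathcomp Require Import mxtens.
From mathcomp Require Import boolp reals sequences exp.
From mathcomp Require Import spectral complex.
From mathcomp Require Import zify ring lra.
Set Implicit Arguments. Unset Strict Implicit. Unset Printing Implicit Defensive.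
Import Order.TTheory GRing.Theory Num.Theory.
Local Open Scope ring_scope.

(** * Rademacher averages over a finite class *)

Section Rademacher.
Context (R : realType) (W : finType) (w0 : W).

(** The point [w0] only witnesses that the class is nonempty: as the default value it is itself one
    of the competitors, so the result is the true maximum. *)
Definition fmax (A : W -> R) : R := \big[Num.max/A w0]_w A w.

Lemma fmax_ge A w : A w <= fmax A.
Proof. exact: le_bigmax. Qed.

Lemma fmax_le A c : (forall w, A w <= c) -> fmax A <= c.
Proof. by move=> le_c; apply: bigmax_le. Qed.

(* Expected maximum of [A + sum_h (+/- h)] over independent uniform signs, one for
   each [h] in [s]. *)
Fixpoint rad (A : W -> R) (s : seq (W -> R)) : R :=
  if s is h :: s' then
    2^-1 * (rad (fun w => A w + h w) s' + rad (fun w => A w - h w) s')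
  else fmax A.

(** With [w] and [w'] competing in the two maxima on the left, the sum is
    [A w + A w' + (x w - x w')]. The sign of [z w - z w'] decides which of the two goes to which
    maximum on the right. *)
Lemma fmax_swap_contraction A x z :
  (forall w w', `|x w - x w'| <= `|z w - z w'|) ->
  fmax (fun w => A w + x w) + fmax (fun w => A w - x w) <=
  fmax (fun w => A w + z w) + fmax (fun w => A w - z w).
Proof.
move=> xz; rewrite -lerBrDr; apply: fmax_le => w; rewrite lerBrDr -lerBrDl.
apply: fmax_le => w'; rewrite lerBrDl.
have /ler_normlP[_ h] := xz w w'.
have p1 := fmax_ge (fun w => A w + z w) w.
have p2 := fmax_ge (fun w => A w + z w) w'.
have q1 := fmax_ge (fun w => A w - z w) w.
have q2 := fmax_ge (fun w => A w - z w) w'.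
move: h; case: (ger0P (z w - z w')) => _ h; lra.
Qed.

(** The increments of the other signs are absorbed into [A]; [addAC] moves the swapped increment
    back to the last place, where the induction hypothesis sees it. *)
Lemma rad_swap_contraction s A x z :
  (forall w w', `|x w - x w'| <= `|z w - z w'|) ->
  rad (fun w => A w + x w) s + rad (fun w => A w - x w) s <=
  rad (fun w => A w + z w) s + rad (fun w => A w - z w) s.
Proof.
move=> xz; elim: s A => [|h s IHs] A /=; first exact: fmax_swap_contraction.
have IHp := IHs (fun w => A w + h w); have IHm := IHs (fun w => A w - h w).
have addAC u v : (fun w => A w + u w + v w) = (fun w => A w + v w + u w) :> (W -> R).
  by apply/funext => w; rewrite addrAC.
rewrite (addAC h x) (addAC h z) (addAC h (fun w => - x w)) (addAC h (fun w => - z w)) in IHp.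
rewrite (addAC (fun w => - h w) x) (addAC (fun w => - h w) z) in IHm.
rewrite (addAC (fun w => - h w) (fun w => - x w)) (addAC (fun w => - h w) (fun w => - z w)) in IHm.
lra.
Qed.

Lemma rad_contraction I (r : seq I) A (x z : I -> W -> R) :
  (forall i w w', `|x i w - x i w'| <= `|z i w - z i w'|) ->
  rad A [seq x i | i <- r] <= rad A [seq z i | i <- r].
Proof.
move=> xz; elim: r A => [|i r IHr] A //=.
rewrite ler_pM2l ?invr_gt0 ?ltr0n //.
by apply: le_trans (rad_swap_contraction _ _ (xz i)); apply: lerD.
Qed.

(** A uniform sign and its negation have the same law, so the plus branch of [x] is paired with the
    minus branch of [y]; the base case is subadditivity of the maximum. *)
Lemma rad_sub I (r : seq I) A A' (x y : I -> W -> R) :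
  rad (fun w => A w + A' w) [seq (fun w => x i w - y i w) | i <- r] <=
  rad A [seq x i | i <- r] + rad A' [seq y i | i <- r].
Proof.
elim: r A A' => [|i r IHr] A A' /=.
  by apply: fmax_le => w; apply: lerD; apply: fmax_ge.
have := IHr (fun w => A w + x i w) (fun w => A' w - y i w).
have := IHr (fun w => A w - x i w) (fun w => A' w + y i w).
rewrite (_ : (fun w => A w - x i w + _) =
  (fun w => A w + A' w - (x i w - y i w))); last by apply/funext => w; ring.
rewrite (_ : (fun w => A w + x i w + _) =
  (fun w => A w + A' w + (x i w - y i w))); last by apply/funext => w; ring.
lra.
Qed.

Lemma sqrt_add_le (x y : R) : 0 <= x -> 0 <= y ->
  Num.sqrt x + Num.sqrt y <= 2 * Num.sqrt ((x + y) / 2).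
Proof.
move=> x0 y0; have := sqr_sqrtr x0; have := sqr_sqrtr y0.
have xy0 : 0 <= (x + y) / 2 by lra.
have := sqr_sqrtr xy0.
move: (sqrtr_ge0 x) (sqrtr_ge0 y) (sqrtr_ge0 ((x + y) / 2)).
move: (Num.sqrt x) (Num.sqrt y) (Num.sqrt ((x + y) / 2)) => a b c a0 b0 c0 hc hb ha.
rewrite -(@ler_pXn2r _ 2) ?nnegrE //; try lra.
have := sqr_ge0 (a - b); rewrite sqrrB sqrrD exprMn.
by rewrite ha hb hc; lra.
Qed.

Lemma cauchy_schwarz_sum (I : finType) (P : pred I) (a b : I -> R) :
  (\sum_(i | P i) a i * b i) ^+ 2 <=
  (\sum_(i | P i) a i ^+ 2) * (\sum_(i | P i) b i ^+ 2).
Proof.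
set x := \sum_(i | P i) a i ^+ 2; set y := \sum_(i | P i) b i ^+ 2.
set c := \sum_(i | P i) a i * b i.
have x0 : 0 <= x by apply: sumr_ge0 => i _; apply: sqr_ge0.
have pos s t : 0 <= s ^+ 2 * x + t ^+ 2 * y - s * t * (2 * c).
  rewrite /x /y /c !mulr_sumr -big_split -sumrB /=; apply: sumr_ge0 => i _.
  by have := sqr_ge0 (s * a i - t * b i); rewrite !expr2; nra.
(* The nonnegative quadratic form of [pos] at [(c, x)] equals [x * (x * y - c ^+ 2)]. If [x]
   vanishes, so does every [a i]. *)
have [xp|x_le0] := ltrP 0 x.
  have := pos c x; rewrite (_ : _ + _ - _ = x * (x * y - c ^+ 2)); last by ring.
  by rewrite pmulr_rge0 // subr_ge0.
have x_eq : x = 0 by apply/eqP; rewrite eq_le x0 x_le0.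
suff c0 : c = 0 by rewrite c0 x_eq mul0r expr0n /= lexx.
apply: big1 => i Pi; move/eqP: x_eq; rewrite psumr_eq0 => [|j _]; last exact: sqr_ge0.
by move=> /allP/(_ i); rewrite mem_index_enum Pi sqrf_eq0 => /(_ isT)/eqP ->; rewrite mul0r.
Qed.

(** The offset [q] collects the signs already drawn. The parallelogram law averages the squared
    norms of [q + u i] and [q - u i], concavity of the square root keeps the bound, and
    Cauchy-Schwarz ends the recursion. *)
Lemma rad_linear D I (r : seq I) (v : W -> 'I_D -> R) (q : 'I_D -> R)
    (u : I -> 'I_D -> R) (Lam : R) : 0 <= Lam ->
  (forall w, \sum_a v w a ^+ 2 <= Lam ^+ 2) ->
  rad (fun w => \sum_a v w a * q a) [seq (fun w => \sum_a v w a * u i a) | i <- r]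
  <= Lam * Num.sqrt (\sum_a q a ^+ 2 + \sum_(i <- r) \sum_a u i a ^+ 2).
Proof.
move=> Lam0 vLam; elim: r q => [|i r IHr] q /=.
  rewrite big_nil addr0; apply: fmax_le => w; apply: le_trans (ler_norm _) _.
  rewrite -sqrtr_sqr -[Lam](ger0_norm Lam0) -sqrtr_sqr -sqrtrM ?sqr_ge0 //.
  rewrite ler_wsqrtr //.
  apply: le_trans (cauchy_schwarz_sum _ _ _) _.
  by rewrite ler_wpM2r // sumr_ge0 // => a _; apply: sqr_ge0.
have sumq_ge0 (p : 'I_D -> R) : 0 <= \sum_a p a ^+ 2.
  by apply: sumr_ge0 => a _; apply: sqr_ge0.
have rest_ge0 : 0 <= \sum_(j <- r) \sum_a u j a ^+ 2 by apply: sumr_ge0.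
have := IHr (fun a => q a + u i a); have := IHr (fun a => q a - u i a).
rewrite (_ : (fun w => \sum_a v w a * (q a - u i a)) = (fun w =>
  \sum_a v w a * q a - \sum_a v w a * u i a)); last first.
  by apply/funext => w; rewrite -sumrB; apply: eq_bigr => a _; rewrite mulrBr.
rewrite (_ : (fun w => \sum_a v w a * (q a + u i a)) = (fun w =>
  \sum_a v w a * q a + \sum_a v w a * u i a)); last first.
  by apply/funext => w; rewrite -big_split; apply: eq_bigr => a _; rewrite mulrDr.
move=> hm hp.
have := @sqrt_add_le (\sum_a (q a + u i a) ^+ 2 + \sum_(j <- r) \sum_a u j a ^+ 2)
  (\sum_a (q a - u i a) ^+ 2 + \sum_(j <- r) \sum_a u j a ^+ 2)
  (addr_ge0 (sumq_ge0 _) rest_ge0) (addr_ge0 (sumq_ge0 _) rest_ge0).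
rewrite (_ : (_ + _) / 2 = \sum_a q a ^+ 2 + \sum_(j <- i :: r) \sum_a u j a ^+ 2).
  by move=> /(ler_wpM2l Lam0); rewrite mulrDr => h; lra.
have parallelogram : \sum_a (q a + u i a) ^+ 2 + \sum_a (q a - u i a) ^+ 2 =
    2 * (\sum_a q a ^+ 2 + \sum_a u i a ^+ 2).
  by rewrite -!big_split mulr_sumr; apply: eq_bigr => a _ /=; ring.
by rewrite big_cons; lra.
Qed.

(** Reindexing the sum over [P] by [t i] flips the sign of [h i] and fixes everything else, so both
    signs contribute equally. Each processed [h i] joins [A], which stays invariant under the
    symmetries still to come. *)
Lemma sum_fmax_symmetrize (P : finType) (I : eqType) (r : seq I)
    (t : I -> P -> P) (h : I -> P -> W -> R) (A : P -> W -> R) :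
  uniq r -> (forall i, injective (t i)) ->
  (forall i, i \in r -> forall p w, A (t i p) w = A p w) ->
  (forall i p w, h i (t i p) w = - h i p w) ->
  (forall i j p w, i != j -> h j (t i p) w = h j p w) ->
  \sum_p fmax (fun w => A p w + \sum_(i <- r) h i p w) =
  \sum_p rad (A p) [seq h i p | i <- r].
Proof.
move=> + t_inj + h_i h_j; elim: r A => [|i r IHr] A /=.
  move=> _ _; apply: eq_bigr => p _; congr fmax.
  by apply/funext => w; rewrite big_nil addr0.
case/andP=> ir ur At; rewrite -mulr_sumr big_split /=.
have -> : \sum_p rad (fun w => A p w - h i p w) [seq h j p | j <- r] =
          \sum_p rad (fun w => A p w + h i p w) [seq h j p | j <- r].
  rewrite (reindex_inj (t_inj i)); apply: eq_bigr => p _; congr rad.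
    by apply/funext => w; rewrite At ?mem_head // h_i opprK.
  apply/eq_in_map => j jr; apply/funext => w; rewrite h_j //.
  by apply: contraNneq ir => ->.
rewrite (_ : 2^-1 * _ = \sum_p rad (fun w => A p w + h i p w) [seq h j p | j <- r]); last by lra.
rewrite -IHr //.
  apply: eq_bigr => p _; congr fmax; apply/funext => w.
  by rewrite big_cons addrA.
move=> j jr p w; rewrite At ?inE ?jr ?orbT // h_j //.
by apply: contraNneq ir => <-.
Qed.

End Rademacher.

(** * Sampling without replacement *)

Section SamplingWithoutReplacement.
Context (R : realType) (T : finType).
Implicit Types (A S : {set T}) (g : {set T} -> R).

Definition msub A m := [set S : {set T} | S \subset A & #|S| == m].

Definition mean A m g : R := 'C(#|A|, m)%:R^-1 * \sum_(S in msub A m) g S.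

Lemma card_msub A m : #|msub A m| = 'C(#|A|, m).
Proof. exact: cards_draws. Qed.

(** Double counting of pairs [x \in S]: every set of size [m.+1] arises once for each of its
    points. *)
Lemma sum_msub_recl A (m : nat) g :
  \sum_(x in A) \sum_(S in msub (A :\ x) m) g (x |: S) =
  m.+1%:R * \sum_(S in msub A m.+1) g S.
Proof.
transitivity (\sum_(x in A) \sum_(S in msub A m.+1 | x \in S) g S).
  apply: eq_bigr => x xA.
  rewrite [RHS](reindex_onto (fun S => x |: S) (fun S => S :\ x)) /=; last first.
    by move=> S /andP[_ xS]; rewrite setD1K.
  apply: eq_bigl => S.
  rewrite setU11 andbT !inE subsetD1 subUset sub1set xA /=.
  have [xS|xS] := boolP (x \in S).
    rewrite andbF; apply/esym/negP => /andP[_ /eqP SE].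
    by move: xS; rewrite -SE !inE eqxx.
  by rewrite cardsU1 xS setU1K // eqxx !andbT.
rewrite (exchange_big_dep [in msub A m.+1]) /= => [|x S _ /andP[]//].
rewrite mulr_sumr; apply: eq_bigr => S; rewrite inE => /andP[/subsetP SA /eqP cS].
rewrite (eq_bigl [in S]) => [|x]; last first.
  rewrite cS eqxx (introT subsetP SA) /=.
  by case: (boolP (x \in S)) => [/SA -> //|_]; rewrite andbF.
by rewrite sumr_const cS mulr_natl.
Qed.

(** A uniform sample is a uniform first point together with a uniform sample of the remaining
    points. *)
Lemma mean_recl A m g : (0 < #|A|)%N ->
  mean A m.+1 g = #|A|%:R^-1 * \sum_(x in A) mean (A :\ x) m (fun S => g (x |: S)).
Proof.
(* When [A] is too small the binomial coefficients vanish, and both sides are 0 because the inverse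
   of 0 is 0. *)
move=> A_gt0; have [mA|mA] := ltnP m #|A|; last first.
  rewrite /mean bin_small // invr0 mul0r big1 ?mulr0 // => x xA.
  rewrite bin_small ?invr0 ?mul0r //.
  by rewrite (cardsD1 x A) xA in mA A_gt0 *; lia.
rewrite (eq_bigr (fun x => 'C(#|A|.-1, m)%:R^-1 *
    \sum_(S in msub (A :\ x) m) g (x |: S))) => [|x xA]; last first.
  by rewrite /mean (cardsD1 x A) xA.
rewrite -mulr_sumr sum_msub_recl /mean !mulrA; congr (_ * _).
have binA := mul_bin_diag #|A| m.
have := congr1 (fun k => k%:R : R) binA; rewrite /= !natrM => binR.
have nz1 : #|A|%:R != 0 :> R by rewrite pnatr_eq0 -lt0n.
have nz2 : 'C(#|A|, m.+1)%:R != 0 :> R by rewrite pnatr_eq0 -lt0n bin_gt0.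
have nz3 : 'C(#|A|.-1, m)%:R != 0 :> R by rewrite pnatr_eq0 -lt0n bin_gt0; lia.
apply: (mulfI nz2); rewrite mulfV //; apply: (mulfI nz1); apply: (mulfI nz3).
rewrite mulr1 [RHS](_ : _ = m.+1%:R * 'C(#|A|, m.+1)%:R); first by rewrite -binR mulrC.
by field; rewrite nz1 nz3.
Qed.

Lemma mean_ext A m g g' : (forall S, S \subset A -> #|S| = m -> g S = g' S) ->
  mean A m g = mean A m g'.
Proof.
move=> gg'; congr (_ * _); apply: eq_bigr => S.
by rewrite inE => /andP[SA /eqP cS]; apply: gg'.
Qed.

Lemma mean_le A m g g' : (forall S, S \subset A -> #|S| = m -> g S <= g' S) ->
  mean A m g <= mean A m g'.
Proof.
move=> gg'; apply: ler_wpM2l; first by rewrite invr_ge0.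
apply: ler_sum => S.
by rewrite inE => /andP[SA /eqP cS]; apply: gg'.
Qed.

Lemma mean_const A m (c : R) : (m <= #|A|)%N -> mean A m (fun=> c) = c.
Proof.
move=> mA; rewrite /mean sumr_const card_msub -[c *+ _]mulr_natl mulrA mulVf ?mul1r //.
by rewrite pnatr_eq0 -lt0n bin_gt0.
Qed.

Lemma meanB A m g g' : mean A m (fun S => g S - g' S) = mean A m g - mean A m g'.
Proof. by rewrite /mean sumrB mulrBr. Qed.

Lemma meanZ A m (c : R) g : mean A m (fun S => c * g S) = c * mean A m g.
Proof. by rewrite /mean -mulr_sumr mulrCA. Qed.

Lemma mean_norm_le A m g (c : R) : (m <= #|A|)%N ->
  (forall S, S \subset A -> #|S| = m -> `|g S| <= c) -> `|mean A m g| <= c.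
Proof.
move=> mA gc; rewrite ler_norml -{1}(mean_const (- c) mA) -{2}(mean_const c mA).
by rewrite !mean_le // => S SA cS; have := gc S SA cS; rewrite ler_norml => /andP[].
Qed.

Lemma perm_imset_subset (s : {perm T}) S A : (s @: S \subset s @: A) = (S \subset A).
Proof.
apply/idP/idP => [/subsetP sSA|]; last exact: imsetS.
apply/subsetP => x xS; have := sSA (s x); rewrite !mem_imset; first exact.
all: exact: perm_inj.
Qed.

Lemma mean_perm (s : {perm T}) A m g :
  mean (s @: A) m g = mean A m (fun S => g (s @: S)).
Proof.
have sI : injective (fun S : {set T} => s @: S) by apply/imset_inj/perm_inj.
rewrite /mean card_imset; last exact: perm_inj.
congr (_ * _); rewrite (reindex_inj sI) /=; apply: eq_bigl => S.
rewrite !inE card_imset; last exact: perm_inj.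
by rewrite perm_imset_subset.
Qed.

(** For [y <= 1/2], [expR y <= 1 / (1 - y) <= 1 + y + 2 * y ^+ 2], and [1 + 2 * y ^+ 2] is below the
    exponential on the right. For [y > 1/2], [y <= 2 * y ^+ 2] already suffices. *)
Lemma expR_le_quad (y : R) : expR y <= y + expR (2 * y ^+ 2).
Proof.
have e2 := expR_ge1Dx (2 * y ^+ 2); have em := expR_ge1Dx (- y).
have ep := expR_gt0 y; have eM : expR y * expR (- y) = 1 by rewrite -expRD subrr expR0.
have [y_le|y_gt] := lerP y 2^-1.
  suff : expR y <= 1 + y + 2 * y ^+ 2 by lra.
  have ey : expR y * (1 - y) <= 1 by rewrite -eM; apply: ler_wpM2l; [exact: ltW | lra].
  have q0 : 0 <= y ^+ 2 by exact: sqr_ge0.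
  have : 1 <= (1 + y + 2 * y ^+ 2) * (1 - y).
    rewrite (_ : _ * _ = 1 + y ^+ 2 * (1 - 2 * y)); last by ring.
    by rewrite lerDl mulr_ge0 //; lra.
  by move=> /(le_trans ey); rewrite ler_pM2r //; lra.
suff : expR y <= expR (2 * y ^+ 2) by lra.
by rewrite ler_expR expr2; nra.
Qed.

(** The centred values sum to zero, which removes the linear term of [expR_le_quad], and each is at
    most [c] in absolute value. The constant 2 is larger than the sharp 1/8 but has an elementary
    proof. *)
Lemma hoeffding_mgf A (v : T -> R) (c : R) : (0 < #|A|)%N ->
  (forall x y, x \in A -> y \in A -> `|v x - v y| <= c) ->
  #|A|%:R^-1 * \sum_(x in A) expR (v x - #|A|%:R^-1 * \sum_(y in A) v y) <=
  expR (2 * c ^+ 2).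
Proof.
move=> A_gt0 vc; set mu := _ * \sum_(y in A) v y.
have A_pos : 0 < #|A|%:R :> R by rewrite ltr0n.
have sum_v : \sum_(x in A) (v x - mu) = 0.
  rewrite sumrB sumr_const -[mu *+ _]mulr_natl /mu mulrA mulfV ?gt_eqF // mul1r subrr //.
have v_mu x : x \in A -> (v x - mu) ^+ 2 <= c ^+ 2.
  move=> xA; have mu_eq : v x - mu = #|A|%:R^-1 * \sum_(y in A) (v x - v y).
    rewrite sumrB sumr_const -[v x *+ _]mulr_natl mulrBr mulrA mulVf ?gt_eqF // mul1r //.
  have c0 : 0 <= c by apply: le_trans (vc _ _ xA xA).
  rewrite -ler_sqrt ?sqr_ge0 // !sqrtr_sqr (ger0_norm c0) mu_eq normrM normfV.
  rewrite (ger0_norm (ltW A_pos)) ler_pdivrMl //.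
  apply: le_trans (ler_norm_sum _ _ _) _.
  apply: (@le_trans _ _ (\sum_(y in A) c)); first by apply: ler_sum => y; apply: vc.
  by rewrite sumr_const mulr_natl.
rewrite ler_pdivrMl //.
apply: (@le_trans _ _ (\sum_(x in A) ((v x - mu) + expR (2 * c ^+ 2)))).
  apply: ler_sum => x xA; apply: le_trans (expR_le_quad _) _.
  by rewrite lerD2l ler_expR ler_pM2l // v_mu.
by rewrite big_split /= sum_v add0r sumr_const -[leLHS]mulr_natl.
Qed.

(* Revealing one sampled point [x] at a time is a martingale whose increments are
   bounded by [c]: transposing [x] and [y] maps [A :\ x] onto [A :\ y]. *)
Lemma mean_mgf m A g (c : R) : (m <= #|A|)%N ->
  (forall S x y, S \subset A -> #|S| = m -> x \in A -> y \in A ->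
    `|g (tperm x y @: S) - g S| <= c) ->
  mean A m (fun S => expR (g S - mean A m g)) <= expR (2 * m%:R * c ^+ 2).
Proof.
elim: m A g => [|m IHm] A g mA gc.
  rewrite mulr0 mul0r expR0 (mean_ext (g' := fun=> 1)) ?mean_const //.
  move=> S SA /cards0_eq ->; rewrite (mean_ext (g := g) (g' := fun=> g set0)) ?mean_const //.
    by rewrite subrr expR0.
  by move=> S' _ /cards0_eq ->.
have A_gt0 : (0 < #|A|)%N by apply: leq_trans mA.
pose mu x := mean (A :\ x) m (fun S => g (x |: S)).
have mAx x : x \in A -> (m <= #|A :\ x|)%N.
  by move=> xA; move: mA; rewrite (cardsD1 x A) xA.
have cardU x S : S \subset A :\ x -> #|S| = m -> #|x |: S| = m.+1.
  by rewrite subsetD1 => /andP[_ xS] cS; rewrite cardsU1 xS cS.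
have subU x S : x \in A -> S \subset A :\ x -> x |: S \subset A.
  by rewrite subsetD1 subUset sub1set => -> /andP[].
have mu_swap x y : x \in A -> y \in A -> `|mu x - mu y| <= c.
  move=> xA yA; have imA : A :\ y = tperm x y @: (A :\ x).
    apply/setP => z; rewrite -[z](tpermK x y); move: (tperm x y z) => z'.
    rewrite mem_imset; last exact: perm_inj.
    rewrite !inE; case: (tpermP x y z') => [->|->|/eqP zx /eqP zy].
    - by rewrite !eqxx.
    - by rewrite xA yA eq_sym.
    - by rewrite zx zy.
  rewrite distrC /mu imA mean_perm.
  rewrite -meanB; apply: mean_norm_le => [|S SA cS]; first exact: mAx.
  (* Both conditional means now run over the same sets [S], and the two completed samples differ by
     one transposition, so the bounded difference hypothesis applies. *)
  rewrite (_ : y |: _ = tperm x y @: (x |: S)).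
    by apply: gc => //; [exact: subU | exact: cardU].
  by rewrite imsetU1 tpermL.
rewrite mean_recl //; set M := mean A m.+1 g.
have M_eq : M = #|A|%:R^-1 * \sum_(x in A) mu x by rewrite /M mean_recl.
apply: (@le_trans _ _ (#|A|%:R^-1 *
    \sum_(x in A) expR (2 * m%:R * c ^+ 2) * expR (mu x - M))).
  apply: ler_wpM2l; first by rewrite invr_ge0.
  apply: ler_sum => x xA.
  (* The deviation splits into that of the first draw, [mu x - M], and that of the rest given [x].
     The induction hypothesis bounds the latter and [hoeffding_mgf] the former. *)
  rewrite (mean_ext (g' := fun S => expR (mu x - M) * expR (g (x |: S) - mu x))).
    rewrite meanZ mulrC ler_pM2r ?expR_gt0 //; apply: IHm => [|S y z SA cS yA zA]; first exact: mAx.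
    rewrite (_ : x |: _ = tperm y z @: (x |: S)).
      apply: gc; [exact: subU | exact: cardU | |].
        by move: yA; rewrite inE => /andP[].
      by move: zA; rewrite inE => /andP[].
    move: yA zA; rewrite !inE => /andP[yx _] /andP[zx _].
    by rewrite imsetU1 tpermD.
  by move=> S _ _; rewrite -expRD; congr expR; ring.
rewrite -mulr_sumr mulrCA -[m.+1]addn1 natrD mulrDr mulr1 mulrDl expRD ler_pM2l ?expR_gt0 //.
by rewrite M_eq; apply: hoeffding_mgf.
Qed.

Lemma mean_concentration m A g (c t : R) : (m <= #|A|)%N ->
  0 < c -> (0 < m)%N -> 0 <= t ->
  (forall S x y, S \subset A -> #|S| = m -> x \in A -> y \in A ->
    `|g (tperm x y @: S) - g S| <= c) ->
  mean A m (fun S => (mean A m g + t < g S)%R%:R) <= expR (- (t ^+ 2 / (8 * m%:R * c ^+ 2))).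
Proof.
move=> mA c_gt0 m_gt0 t0 gc; have mR : 0 < m%:R :> R by rewrite ltr0n.
have c2 : 0 < c ^+ 2 by rewrite exprn_gt0.
(* Minimiser of the Chernoff exponent [- (s * t) + 2 * m%:R * (s * c) ^+ 2]. *)
pose s := t / (4 * m%:R * c ^+ 2).
have s0 : 0 <= s by rewrite divr_ge0 // !mulr_ge0 // ltW.
have sgc S x y : S \subset A -> #|S| = m -> x \in A -> y \in A ->
    `|s * g (tperm x y @: S) - s * g S| <= s * c.
  by move=> *; rewrite -mulrBr normrM (ger0_norm s0) ler_wpM2l // gc.
have mgf := mean_mgf mA sgc; rewrite meanZ in mgf; set mu := mean A m g in mgf *.
apply: (@le_trans _ _ (expR (- (s * t)) * expR (2 * m%:R * (s * c) ^+ 2))).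
  rewrite -ler_pdivrMl ?expR_gt0 //; apply: le_trans mgf; rewrite -meanZ.
  apply: mean_le => S _ _; case: ltrP => [lt_g|_]; last by rewrite mulr0 expR_ge0.
  rewrite mulr1 -expRN opprK ler_expR -mulrBr ler_wpM2l //; lra.
rewrite -expRD ler_expR le_eqVlt; apply/orP; left; apply/eqP.
rewrite /s; field; rewrite !gt_eqF //.
Qed.

End SamplingWithoutReplacement.

(** * Largest eigenvalue of a Gram matrix *)

Section Spectral.
Local Open Scope sesquilinear_scope.
Context (R : realType).

Lemma sum_sqr_ge0 (I : Type) (r : seq I) (P : pred I) (x : I -> R) :
  0 <= \sum_(i <- r | P i) x i ^+ 2.
Proof. by apply: sumr_ge0 => i _; apply: sqr_ge0. Qed.

(** The rows of the diagonalising unitary matrix are left eigenvectors, nonzero because that matrix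
    is invertible. *)
Lemma spectral_diag_eigenvalue (C : numClosedFieldType) n (A : 'M[C]_n) i :
  A \is normalmx -> eigenvalue A (spectral_diag A 0 i).
Proof.
move=> /orthomx_spectralP A_eq; apply/eigenvalueP; exists (row i (spectralmx A)).
  rewrite [X in _ *m X = _]A_eq -row_mul !mulmxA mulmxV ?spectral_unit // mul1mx.
  by rewrite row_mul row_diag_mx -scalemxAl -rowE.
apply: contraTneq (spectral_unit A) => row0; rewrite -row_free_unit.
by apply/row_freePn; exists i; rewrite row0 sub0mx.
Qed.

(** [K] is diagonalised over the complex numbers. With [y] the coordinates of [x] in the eigenbasis,
    the quadratic form is a sum of eigenvalues weighted by [|y i|^2], and the weights sum to the
    squared norm of [x]. *)
Lemma symmetric_rayleigh_le n (K : 'M[R]_n) (lam : R) (x : 'cV[R]_n) :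
  K^T = K -> (forall a, eigenvalue K a -> a <= lam) ->
  (x^T *m K *m x) 0 0 <= lam * \sum_i x i 0 ^+ 2.
Proof.
move=> K_sym K_lam; pose toC := real_complex R; pose A := map_mx toC K.
have A_herm : A \is hermsymmx.
  apply: realsym_hermsym; last first.
    by apply/mxOverP => i j; rewrite mxE; apply/complex_realP; exists (K i j).
  by apply/is_hermitianmxP/matrixP => i j; rewrite expr0 scale1r !mxE -[in LHS]K_sym mxE.
have A_normal := hermitian_normalmx A_herm.
pose P := spectralmx A; pose y := P *m map_mx toC x.
have P_unit : P^t* *m P = 1%:M.
  by rewrite -invmx_unitary ?spectral_unitarymx // mulVmx ?spectral_unit.
have x_adj : (map_mx toC x)^t* = map_mx toC x^T.
  by apply/matrixP => i j; rewrite !mxE; apply/CrealP/complex_realP; exists (x j i).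
have y_adj : y^t* = map_mx toC x^T *m P^t*.
  by rewrite /y trmx_mul map_mxM x_adj.
have quad : toC ((x^T *m K *m x) 0 0) = \sum_i spectral_diag A 0 i * `|y i 0| ^+ 2.
  have -> : toC ((x^T *m K *m x) 0 0) = (y^t* *m diag_mx (spectral_diag A) *m y) 0 0.
    rewrite y_adj /y -!mulmxA (mulmxA (P^t*)) mulmxA (mulmxA (P^t* *m _)).
    have /orthomx_spectralP A_eq := A_normal.
    have -> : P^t* *m diag_mx (spectral_diag A) *m P = A.
      by rewrite [RHS]A_eq invmx_unitary ?spectral_unitarymx.
    by rewrite mulmxA -!map_mxM [RHS]mxE.
  rewrite -mulmxA mul_diag_mx mxE; apply: eq_bigr => i _.
  by rewrite !mxE normCK mulrCA [_^* * _]mulrC.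
have norm2 : toC (\sum_i x i 0 ^+ 2) = \sum_i `|y i 0| ^+ 2.
  transitivity ((y^t* *m y) 0 0).
    rewrite y_adj /y mulmxA -(mulmxA _ (P^t*)) P_unit mulmx1 -map_mxM !mxE.
    by congr toC; apply: eq_bigr => i _; rewrite mxE expr2.
  by rewrite mxE; apply: eq_bigr => i _; rewrite !mxE normCK mulrC.
have : toC ((x^T *m K *m x) 0 0) <= toC (lam * \sum_i x i 0 ^+ 2).
  have -> : toC (lam * \sum_i x i 0 ^+ 2) = toC lam * toC (\sum_i x i 0 ^+ 2) by apply: rmorphM.
  rewrite norm2 quad mulr_sumr; apply: ler_sum => i _.
  apply: ler_wpM2r; first by rewrite exprn_ge0.
  (* A hermitian matrix has real eigenvalues, and a real root of the characteristic polynomial of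
     [A] is a root of that of [K]. *)
  have := hermitian_spectral_diag_real A_herm => /mxOverP/(_ 0 i)/complex_realP[a a_eq].
  rewrite a_eq lecR; apply: K_lam.
  have := spectral_diag_eigenvalue i A_normal.
  by rewrite a_eq !eigenvalue_root_char -map_char_poly fmorph_root.
by rewrite lecR.
Qed.

(** Duality: for [y = U^T x], [|y|^2 = <x, U y> <= |x| |U y|], while [|U y|^2] is the quadratic form
    of the Gram matrix at [y], hence at most [lam * |y|^2]. Squaring and dividing by [|y|^2]
    concludes. *)
Lemma gram_frame_le d n (U : 'M[R]_(d, n)) (lam : R) (x : 'I_d -> R) :
  0 <= lam -> (forall a, eigenvalue (U^T *m U) a -> a <= lam) ->
  \sum_j (\sum_a U a j * x a) ^+ 2 <= lam * \sum_a x a ^+ 2.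
Proof.
move=> lam0 K_lam; pose y : 'cV_n := \col_j \sum_a U a j * x a.
have y_eq : \sum_j (\sum_a U a j * x a) ^+ 2 = \sum_j y j 0 ^+ 2.
  by apply: eq_bigr => j _; rewrite mxE.
have y_dual : \sum_j y j 0 ^+ 2 = \sum_a x a * (U *m y) a 0.
  under [RHS]eq_bigr => a _ do rewrite mxE mulr_sumr.
  rewrite exchange_big; apply: eq_bigr => j _ /=.
  rewrite expr2 {1}mxE mulr_suml; apply: eq_bigr => a _; ring.
have Uy_le : \sum_a (U *m y) a 0 ^+ 2 <= lam * \sum_j y j 0 ^+ 2.
  apply: le_trans (@symmetric_rayleigh_le _ (U^T *m U) lam y _ K_lam).
    rewrite mulmxA -mulmxA -trmx_mul [leRHS]mxE.
    by under [leRHS]eq_bigr => a _ do rewrite mxE -expr2.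
  by rewrite trmx_mul trmxK.
rewrite y_eq; have := cauchy_schwarz_sum xpredT x (fun a => (U *m y) a 0).
rewrite -y_dual; set Y := \sum_j _; set X := \sum_a _.
have X0 : 0 <= X by apply: sum_sqr_ge0.
have [->|Y_neq0] := eqVneq Y 0; first by move=> _; apply: mulr_ge0.
have Y_gt0 : 0 < Y by rewrite lt_def Y_neq0 sum_sqr_ge0.
move=> /le_trans/(_ (ler_wpM2l X0 Uy_le)).
by rewrite expr2 -/Y mulrA ler_pM2r // mulrC.
Qed.

(** Norm of a tensor product: [gram_frame_le] is applied once in each factor, contributing one [lam]
    each time. *)
Lemma gram_frame2_le d n (U : 'M[R]_(d, n)) (lam : R) (W : 'I_d -> 'I_d -> R) :
  0 <= lam -> (forall a, eigenvalue (U^T *m U) a -> a <= lam) ->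
  \sum_i \sum_j (\sum_a \sum_b W a b * (U a i * U b j)) ^+ 2 <=
  lam ^+ 2 * \sum_a \sum_b W a b ^+ 2.
Proof.
move=> lam0 K_lam.
apply: (@le_trans _ _ (\sum_i lam * \sum_b (\sum_a U a i * W a b) ^+ 2)).
  apply: ler_sum => i _; apply: le_trans (gram_frame_le _ lam0 K_lam).
  rewrite le_eqVlt; apply/orP; left; apply/eqP; apply: eq_bigr => j _.
  congr (_ ^+ 2); rewrite exchange_big; apply: eq_bigr => b _ /=.
  by rewrite mulr_sumr; apply: eq_bigr => a _; ring.
rewrite -mulr_sumr exchange_big expr2 -mulrA; apply: ler_wpM2l => //.
rewrite [X in _ <= _ * X]exchange_big mulr_sumr; apply: ler_sum => b _ /=.
exact: gram_frame_le.
Qed.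

End Spectral.

(** * Symmetrization of the transductive gap *)

Section TransductiveGap.
Context (R : realType) (T W : finType) (w0 : W) (L : T -> W -> R).

Definition avg (A : {set T}) (h : T -> R) : R := #|A|%:R^-1 * \sum_(k in A) h k.

Definition gap (S : {set T}) (w : W) : R :=
  avg (~: S) (L^~ w) - avg S (L^~ w).

Lemma imset_permC (s : {perm T}) (S : {set T}) : s @: (~: S) = ~: (s @: S).
Proof.
apply/setP => x; rewrite -[x](permKV s) inE !mem_imset ?inE //; exact: perm_inj.
Qed.

Lemma avg_perm (s : {perm T}) (S : {set T}) h : avg (s @: S) h = avg S (fun k => h (s k)).
Proof.
rewrite /avg card_imset ?big_imset //=; last exact: perm_inj.
by move=> x y _ _; apply: perm_inj.
Qed.

(* The stabiliser of [S] acts transitively on [S]. *)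
Lemma sum_stabilizer (S : {set T}) k0 (h : T -> R) : k0 \in S ->
  \sum_(s : {perm T} | s @: S == S) h (s k0) =
  #|[set s : {perm T} | s @: S == S]|%:R * avg S h.
Proof.
move=> k0S; have S_gt0 : #|S|%:R != 0 :> R.
  by rewrite pnatr_eq0 -lt0n; apply/card_gt0P; exists k0.
apply: (mulfI S_gt0); rewrite [RHS]mulrCA /avg (mulrA #|S|%:R) mulfV // mul1r.
have orbit k : k \in S -> \sum_(s : {perm T} | s @: S == S) h (s k0) =
    \sum_(s : {perm T} | s @: S == S) h (s k).
  move=> kS; rewrite (reindex_inj (mulgI (tperm k0 k))) /=.
  apply: eq_big => [s|s _]; last by rewrite permM tpermL.
  have tS : tperm k0 k @: S = S.
    apply/setP => x; rewrite -[x](tpermK k0 k) mem_imset; last exact: perm_inj.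
    by rewrite tpermK; case: tpermP => [->|->|]; rewrite ?k0S ?kS.
  by rewrite -{1}tS -imset_comp; congr (_ == _); apply: eq_imset => x; rewrite /= permM tpermK.
transitivity (\sum_(k in S) \sum_(s : {perm T} | s @: S == S) h (s k)).
  by rewrite -(eq_bigr _ orbit) sumr_const mulr_natl.
rewrite exchange_big /= (eq_bigr (fun=> \sum_(k in S) h k)) => [|s /eqP sS].
  by rewrite sumr_const cardsE mulr_natl.
by rewrite -{2}sS big_imset //= => x y _ _; apply: perm_inj.
Qed.

Lemma fmax_scale (c : R) (A : W -> R) : 0 <= c ->
  fmax w0 (fun w => c * A w) <= c * fmax w0 A.
Proof. by move=> c0; apply: fmax_le => w; apply: ler_wpM2l => //; apply: fmax_ge. Qed.

Lemma fmax_sum (J : Type) (r : seq J) (P : pred J) (A : J -> W -> R) :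
  fmax w0 (fun w => \sum_(j <- r | P j) A j w) <= \sum_(j <- r | P j) fmax w0 (A j).
Proof. by apply: fmax_le => w; apply: ler_sum => j _; apply: fmax_ge. Qed.

Lemma fmax_dist (A A' : W -> R) c : (forall w, `|A w - A' w| <= c) ->
  `|fmax w0 A - fmax w0 A'| <= c.
Proof.
move=> AA'; rewrite ler_distlC; apply/andP; split.
  rewrite lerBlDr; apply: fmax_le => w.
  by have := AA' w; have := fmax_ge w0 A' w; rewrite ler_distlC; lra.
by apply: fmax_le => w; have := AA' w; have := fmax_ge w0 A w; rewrite ler_distlC; lra.
Qed.

(** The maximum of an average is at most the average of the maxima, which reduces the full gap to
    [p] paired differences. Symmetrizing these and separating the inside points from the outside
    ones costs [V] twice, hence the factor 2. *)
Lemma sum_perm_gap_le (S : {set T}) (p : nat) (V : R) :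
  (0 < p)%N -> (p <= #|S|)%N -> (p <= #|~: S|)%N ->
  (forall a : 'I_p -> T, rad w0 (fun=> 0) [seq L (a i) | i <- enum 'I_p] <= V) ->
  \sum_(s : {perm T}) fmax w0 (gap (s @: S)) <= #|{perm T}|%:R * (2 * V / p%:R).
Proof.
move=> p_gt0 pS pS' radV; have pR : 0 < p%:R :> R by rewrite ltr0n.
pose a i := enum_val (widen_ord pS i) : T.
pose b i := enum_val (widen_ord pS' i) : T.
have aS i : a i \in S by apply: enum_valP.
have bS i : b i \in ~: S by apply: enum_valP.
have a_inj : injective a by move=> i j /enum_val_inj/(congr1 val)/= ij; apply: val_inj.
have b_inj : injective b by move=> i j /enum_val_inj/(congr1 val)/= ij; apply: val_inj.
have ab i j : a i != b j.
  by apply: contraTneq (aS i) => ->; have := bS j; rewrite inE.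
pose h i (s : {perm T}) w := L (s (b i)) w - L (s (a i)) w.
pose stab := [set s : {perm T} | s @: S == S].
have stab_gt0 : 0 < #|stab|%:R :> R.
  rewrite ltr0n; apply/card_gt0P; exists 1%g.
  by rewrite inE; apply/eqP; rewrite -[RHS]imset_id; apply: eq_imset => x; rewrite perm1.
have avg_a i g : avg S g = #|stab|%:R^-1 * \sum_(s in stab) g (s (a i)).
  rewrite (eq_bigl (fun s : {perm T} => s @: S == S)) => [|s]; last by rewrite inE.
  by rewrite sum_stabilizer // mulrA mulVf ?mul1r // gt_eqF.
have avg_b i g : avg (~: S) g = #|stab|%:R^-1 * \sum_(s in stab) g (s (b i)).
  rewrite (eq_bigl (fun s : {perm T} => s @: (~: S) == ~: S)) => [|s].
    rewrite sum_stabilizer // (_ : [set s : {perm T} | s @: (~: S) == ~: S] = stab).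
      by rewrite mulrA mulVf ?mul1r // gt_eqF.
    by apply/setP => s; rewrite !inE imset_permC (inj_eq (@setC_inj _)).
  by rewrite inE imset_permC (inj_eq (@setC_inj _)).
pose H (s : {perm T}) w := p%:R^-1 * \sum_(i <- enum 'I_p) h i s w.
(* [S] and its complement have the same stabiliser, so one average over [stab] turns each [a i] into
   a uniform point of [S] and each [b i] into a uniform point outside it. *)
have gapE (s : {perm T}) w : gap (s @: S) w =
    \sum_(s' in stab) #|stab|%:R^-1 * H (s' * s)%g w.
  have -> : gap (s @: S) w = p%:R^-1 * \sum_(i <- enum 'I_p) gap (s @: S) w.
    rewrite big_const_seq count_predT size_enum_ord iter_addr_0.
    by rewrite -[gap _ _ *+ p]mulr_natl mulrA mulVf ?mul1r // gt_eqF.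
  rewrite -mulr_sumr /H -mulr_sumr mulrCA; congr (_ * _).
  rewrite exchange_big mulr_sumr; apply: eq_bigr => i _ /=.
  rewrite /gap -imset_permC !avg_perm (avg_a i) (avg_b i) -mulrBr -sumrB.
  by congr (_ * _); apply: eq_bigr => s' _; rewrite /h !permM.
(* The left factor of a product acts first, so the transposition exchanges the images of [a i] and
   [b i]. By injectivity and disjointness it moves no other chosen point. *)
have h_swap i (s : {perm T}) w : h i (tperm (a i) (b i) * s)%g w = - h i s w.
  by rewrite /h !permM tpermL tpermR opprB.
have h_fix i j (s : {perm T}) w : i != j -> h j (tperm (a i) (b i) * s)%g w = h j s w.
  move=> ij; rewrite /h !permM !tpermD //; try exact: ab.
  - by rewrite (inj_eq a_inj).
  - by rewrite eq_sym ab.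
  - by rewrite (inj_eq b_inj).
apply: (@le_trans _ _ (\sum_(s : {perm T}) fmax w0 (H s))).
  apply: (@le_trans _ _ (\sum_(s : {perm T}) \sum_(s' in stab)
      #|stab|%:R^-1 * fmax w0 (H (s' * s)%g))).
    apply: ler_sum => s _; have -> : gap (s @: S) = (fun w => \sum_(s' in stab)
      #|stab|%:R^-1 * H (s' * s)%g w) by apply/funext => w; rewrite gapE.
    apply: le_trans (fmax_sum _ _ _) _; apply: ler_sum => s' _.
    by apply: fmax_scale; rewrite invr_ge0.
  rewrite exchange_big /=.
  rewrite (eq_bigr (fun=> #|stab|%:R^-1 * \sum_(s : {perm T}) fmax w0 (H s))).
    by rewrite sumr_const -[_ *+ #|_|]mulr_natl mulrA mulfV ?mul1r // gt_eqF.
  by move=> s' _; rewrite -mulr_sumr [in RHS](reindex_inj (mulgI s')).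
apply: (@le_trans _ _ (p%:R^-1 *
    \sum_(s : {perm T}) fmax w0 (fun w => 0 + \sum_(i <- enum 'I_p) h i s w))).
  rewrite mulr_sumr; apply: ler_sum => s _.
  apply: le_trans (fmax_scale _ _); last by rewrite invr_ge0.
  by apply: fmax_le => w; apply: le_trans (fmax_ge w0 _ w); rewrite add0r.
rewrite (@sum_fmax_symmetrize R W w0 {perm T} 'I_p _
  (fun i s => tperm (a i) (b i) * s)%g h (fun _ _ => 0)) ?enum_uniq //; last first.
  by move=> i; apply: mulgI.
rewrite ler_pdivrMl // mulrCA [p%:R * _]mulrC divfK ?gt_eqF //.
apply: (@le_trans _ _ (\sum_(s : {perm T}) 2 * V)); last first.
  by rewrite sumr_const -[leLHS]mulr_natl.
apply: ler_sum => s _.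
have -> : (fun=> 0) = (fun w : W => 0 + 0) :> (W -> R) by apply/funext => w; rewrite addr0.
apply: le_trans (rad_sub w0 (enum 'I_p) (fun=> 0) (fun=> 0) (fun i => L (s (b i))) (fun i => L (s (a i)))) _.
have := radV (fun i => s (b i)); have := radV (fun i => s (a i)); lra.
Qed.

(** The mean is invariant under relabelling the points, so it may also be averaged over all
    permutations; then [sum_perm_gap_le] applies to each fixed [S]. *)
Lemma mean_gap_le (m p : nat) (V : R) : (m <= #|T|)%N ->
  (0 < p)%N -> (p <= m)%N -> (p <= #|T| - m)%N ->
  (forall a : 'I_p -> T, rad w0 (fun=> 0) [seq L (a i) | i <- enum 'I_p] <= V) ->
  mean [set: T] m (fun S => fmax w0 (gap S)) <= 2 * V / p%:R.
Proof.
move=> mT p_gt0 pm pm' radV; have mT' : (m <= #|[set: T]|)%N by rewrite cardsT.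
have perm_gt0 : 0 < #|{perm T}|%:R :> R.
  by rewrite ltr0n; apply/card_gt0P; exists 1%g.
rewrite -(ler_pM2l perm_gt0).
apply: (@le_trans _ _ (mean [set: T] m
    (fun S => \sum_(s : {perm T}) fmax w0 (gap (s @: S))))).
  rewrite le_eqVlt; apply/orP; left; apply/eqP.
  have -> : mean [set: T] m (fun S => \sum_(s : {perm T}) fmax w0 (gap (s @: S))) =
      \sum_(s : {perm T}) mean [set: T] m (fun S => fmax w0 (gap (s @: S))).
    by rewrite /mean exchange_big mulr_sumr.
  rewrite (eq_bigr (fun=> mean [set: T] m (fun S => fmax w0 (gap S)))) => [|s _].
    by rewrite sumr_const -[RHS]mulr_natl.
  have sT : s @: [set: T] = [set: T].
    by apply/setP => x; rewrite !inE -[x](permKV s) mem_imset ?inE //; apply: perm_inj.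
  by rewrite -[in RHS]sT mean_perm.
rewrite -(mean_const (#|{perm T}|%:R * (2 * V / p%:R)) mT').
apply: mean_le => S _ cS; apply: sum_perm_gap_le => //; rewrite ?cS //.
by rewrite cardsCs setCK cS.
Qed.

(** The sum changes only if exactly one of [x] and [y] is in [S], and then by a difference of two
    values in [[0, B]]. *)
Lemma sum_tperm_dist (S : {set T}) x y (h : T -> R) (B : R) :
  (forall k, 0 <= h k <= B) ->
  `|\sum_(k in tperm x y @: S) h k - \sum_(k in S) h k| <= B.
Proof.
move=> hB; have B0 : 0 <= B by have /andP[h0 hB'] := hB x; apply: le_trans hB'.
have hxy : `|h y - h x| <= B.
  by have := hB x; have := hB y; rewrite ler_distlC; lra.
rewrite big_imset /=; last by move=> ? ? _ _; apply: perm_inj.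
rewrite -sumrB.
have fixes k : k != x -> k != y -> h (tperm x y k) - h k = 0.
  by move=> kx ky; rewrite tpermD 1?eq_sym // subrr.
have [xS|xS] := boolP (x \in S); last first.
  have [yS|yS] := boolP (y \in S); last first.
    rewrite big1 ?normr0 // => k kS; apply: fixes; by apply: contraTneq kS => ->.
  rewrite (bigD1 y) //= tpermR big1 ?addr0 1?distrC // => k /andP[kS ky].
  by apply: fixes => //; apply: contraTneq kS => ->.
rewrite (bigD1 x) //= tpermL; have [yS|yS] := boolP (y \in S :\ x); last first.
  rewrite big1 ?addr0 // => k /andP[kS kx]; apply: fixes => //.
  by apply: contraNneq yS => <-; rewrite !inE kx.
move: yS; rewrite !inE => /andP[yx yS].
rewrite (bigD1 y) ?yS ?yx //= tpermR big1 => [|k /andP[/andP[_ kx] ky]]; last exact: fixes.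
by rewrite addr0 addrA subrK subrr normr0.
Qed.

Lemma gap_tperm_dist (S : {set T}) x y w (B : R) :
  (forall k, 0 <= L k w <= B) ->
  `|gap (tperm x y @: S) w - gap S w| <= B * (#|S|%:R^-1 + #|~: S|%:R^-1).
Proof.
move=> LB; have avgD (A : {set T}) : `|avg (tperm x y @: A) (L^~ w) - avg A (L^~ w)| <= B * #|A|%:R^-1.
  rewrite /avg card_imset; last exact: perm_inj.
  rewrite -mulrBr normrM ger0_norm ?invr_ge0 // mulrC; apply: ler_wpM2r; first by rewrite invr_ge0.
  exact: sum_tperm_dist.
have := avgD S; have := avgD (~: S); rewrite /gap imset_permC.
rewrite mulrDr !ler_distlC => /andP[h1 h2] /andP[h3 h4]; apply/andP; split; lra.
Qed.

End TransductiveGap.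

(** * Pref-Rank solutions *)

Section PrefRank.
Context (R : realType) (n d : nat) (U : 'M[R]_(d, n)) (e : rel 'I_n) (lam : R).
Hypotheses (U_lab : in_Lab e U) (lamP : is_lambda1 (U^T *m U) lam).

Definition feature (k : pairs n) (c : 'I_(d * d)) : R :=
  U (mxtens_unindex c).1 (val k).1 * U (mxtens_unindex c).2 (val k).2.

Lemma scores_feature w k : scores U w k = \sum_c w c ord0 * feature k c.
Proof. by apply: eq_bigr => c _; rewrite /utilde !mxE. Qed.

Lemma feature_unit k : \sum_c feature k c ^+ 2 = 1.
Proof.
case: U_lab => U1 _; rewrite -[RHS]mulr1 -{1}(U1 (val k).1) -(U1 (val k).2) mulr_sum.
by apply: eq_bigr => c _; rewrite exprMn.
Qed.

Lemma sum_mxtens_index (F : 'I_(d * d) -> R) :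
  \sum_c F c = \sum_a \sum_b F (mxtens_index (a, b)).
Proof.
rewrite pair_big (reindex (@mxtens_unindex d d)) /=; last first.
  by exists (@mxtens_index d d) => x _; rewrite (mxtens_unindexK, mxtens_indexK).
by apply: eq_bigr => c _; rewrite -[in LHS](mxtens_unindexK c).
Qed.

(** The Rayleigh quotient at a basis vector is a diagonal entry of the Gram matrix, here 1. A basis
    vector exists because a nonzero eigenvector forces [n > 0]. *)
Lemma lambda1_ge1 : 1 <= lam.
Proof.
case: lamP => /eigenvalueP[v _ v0] lam_max.
have [n0|n_gt0] := posnP n.
  by case/eqP: v0; apply/rowP => j; have := ltn_ord j; rewrite {2}n0.
pose i := Ordinal n_gt0.
have K_sym : (U^T *m U)^T = U^T *m U by rewrite trmx_mul trmxK.
have := symmetric_rayleigh_le (delta_mx i 0) K_sym lam_max.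
have Kii : (U^T *m U) i i = 1.
  case: U_lab => U1 _; rewrite -(U1 i) mxE.
  by apply: eq_bigr => a _; rewrite mxE expr2.
rewrite trmx_delta -rowE -colE [leLHS]mxE [leLHS]mxE Kii (bigD1 i) //=.
rewrite mxE !eqxx expr1n big1 => [|j ji]; first by rewrite addr0 mulr1.
by rewrite mxE (negPf ji) expr0n.
Qed.

(** Scores are entries of the transpose of [U (x) U] applied to [w]. The pairs with [i < j] are some
    of all the index pairs, and the others only add squares. *)
Lemma sum_scores_le w :
  \sum_k scores U w k ^+ 2 <= lam ^+ 2 * \sum_c w c ord0 ^+ 2.
Proof.
have lam0 : 0 <= lam by apply: le_trans lambda1_ge1.
case: (lamP) => _ lam_max.
have := gram_frame2_le (fun a b => w (mxtens_index (a, b)) ord0) lam0 lam_max.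
rewrite -(sum_mxtens_index (fun c => w c ord0 ^+ 2)); apply: le_trans.
rewrite pair_big /=.
pose F (p : 'I_n * 'I_n) := (\sum_a \sum_b
  w (mxtens_index (a, b)) ord0 * (U a p.1 * U b p.2)) ^+ 2.
rewrite (eq_bigr (fun k => F (val k))) => [|k _]; last first.
  rewrite scores_feature sum_mxtens_index /F; congr (_ ^+ 2).
  apply: eq_bigr => a _; apply: eq_bigr => b _.
  by rewrite /feature mxtens_indexK.
have -> : \sum_(k : pairs n) F (val k) = \sum_(p in [set val k | k : pairs n]) F p.
  by rewrite big_imset //= => x y _ _; apply: val_inj.
rewrite [leRHS](bigID [in [set val k | k : pairs n]]) /= lerDl.
by apply: sum_sqr_ge0.
Qed.

Lemma ylab_sign (sigma : 'S_n) k : ylab R sigma k = 1 \/ ylab R sigma k = -1.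
Proof.
rewrite /ylab; have : (sigma (val k).1)%:R - (sigma (val k).2)%:R != 0 :> R.
  rewrite subr_eq0 eqr_nat; apply/eqP => /val_inj/perm_inj k12.
  by have := valP k; rewrite k12 ltnn.
by case: sgrP => //; [left | right].
Qed.

Lemma prefrank_sol_sqr_norm (sigma : 'S_n) (C : R) (S : {set pairs n}) w :
  0 < C -> is_prefrank_sol U sigma C S w ->
  \sum_c w c ord0 ^+ 2 <= C * \sum_(k in S) `|scores U w k|.
Proof.
move=> C_gt0 w_opt; set Q := \sum_c _; set A := \sum_(k in S) _.
have A0 : 0 <= A by apply: sumr_ge0.
have CA0 : 0 <= C * A by rewrite mulr_ge0 // ltW.
rewrite leNgt; apply/negP => lt_Q.
have Q_gt0 : 0 < Q by apply: le_lt_trans lt_Q.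
(* Each hinge term grows by at most [t] times the absolute score, so shrinking [w] by [1 - t]
   changes the objective by at most [- t * (Q - C * A) + t ^+ 2 * Q / 2]. This [t] minimises that
   bound and makes it negative. *)
pose t := (Q - C * A) / Q.
have t_gt0 : 0 < t by rewrite divr_gt0 // subr_gt0.
have tQ : t * Q = Q - C * A by rewrite divfK // gt_eqF.
have := w_opt ((1 - t) *: w); rewrite /prefrank_obj -/Q.
have -> : \sum_c ((1 - t) *: w) c ord0 ^+ 2 = (1 - t) ^+ 2 * Q.
  by rewrite mulr_sumr; apply: eq_bigr => c _; rewrite mxE exprMn.
set H := \sum_(k in S) _; set H' := \sum_(k in S) _.
have H'_le : H' <= H + t * A.
  rewrite mulr_sumr -big_split /=; apply: ler_sum => k _.
  have -> : scores U ((1 - t) *: w) k = (1 - t) * scores U w k.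
    rewrite !scores_feature mulr_sumr; apply: eq_bigr => c _.
    by rewrite mxE -mulrA.
  set s := scores U w k; rewrite ge_max; apply/andP; split.
    by rewrite addr_ge0 ?le_max ?lexx // mulr_ge0 // ltW.
  have : 1 - ylab R sigma k * s <= Num.max 0 (1 - ylab R sigma k * s).
    by rewrite le_max lexx orbT.
  have : ylab R sigma k * s <= `|s|.
    case: (ylab_sign sigma k) => ->; rewrite ?mulN1r ?mul1r; first exact: ler_norm.
    by rewrite -normrN ler_norm.
  move: (Num.max _ _) => M h1 h2; have := ler_wpM2l (ltW t_gt0) h1; lra.
have := ler_wpM2l (ltW C_gt0) H'_le => h1 h2.
have : t * (Q - C * A) <= t * (t * Q / 2) by rewrite !mulrDr in h1; nra.
rewrite ler_pM2l // tQ; lra.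
Qed.

(** Cauchy-Schwarz over [S] and [sum_scores_le] bound [A ^+ 2] by [#|S| * lam ^+ 2 * Q]; inserting
    [Q <= C * A] and cancelling one [Q] leaves the claim. *)
Lemma prefrank_sol_norm_le (sigma : 'S_n) (C : R) (S : {set pairs n}) w :
  0 < C -> is_prefrank_sol U sigma C S w ->
  \sum_c w c ord0 ^+ 2 <= (C * lam * Num.sqrt #|S|%:R) ^+ 2.
Proof.
move=> C_gt0 w_opt; have := prefrank_sol_sqr_norm C_gt0 w_opt.
set Q := \sum_c _; set A := \sum_(k in S) _ => QA.
have A2 : A ^+ 2 <= #|S|%:R * (lam ^+ 2 * Q).
  have := cauchy_schwarz_sum [in S] (fun=> 1) (fun k => `|scores U w k|).
  rewrite (eq_bigr _ (fun k _ => mul1r _)) -/A (eq_bigr _ (fun k _ => expr1n _ _)).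
  rewrite sumr_const; move=> /le_trans; apply; apply: ler_wpM2l => //.
  apply: le_trans (sum_scores_le w); rewrite [leRHS](bigID [in S]) /=.
  rewrite (eq_bigr (fun k => scores U w k ^+ 2)) => [|k _]; last by rewrite real_normK ?num_real.
  by rewrite lerDl sum_sqr_ge0.
have Q0 : 0 <= Q by apply: sum_sqr_ge0.
have [->|Q_neq0] := eqVneq Q 0; first exact: sqr_ge0.
have Q_gt0 : 0 < Q by rewrite lt_def Q_neq0.
rewrite -(ler_pM2r Q_gt0) -expr2 exprMn sqr_sqrtr //.
rewrite (_ : _ * _ * Q = C ^+ 2 * (#|S|%:R * (lam ^+ 2 * Q))); last by ring.
apply: (@le_trans _ _ ((C * A) ^+ 2)); first by rewrite ler_sqr ?nnegrE // (le_trans Q0).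
by rewrite exprMn; apply: ler_wpM2l A2; apply: sqr_ge0.
Qed.

End PrefRank.

(** * Passing from probabilities to means, numerical estimates, and the final bound *)

Lemma prob_subset_ge (R : realType) n m (E : {set pairs n} -> Prop)
    (bad : {set pairs n} -> bool) : (m <= #|{: pairs n}|)%N ->
  (forall S : {set pairs n}, #|S| = m -> ~ E S -> bad S) ->
  1 - mean [set: pairs n] m (fun S => (bad S)%:R) <= prob_subset R m E.
Proof.
move=> mN E_bad; have mT : (m <= #|[set: pairs n]|)%N by rewrite cardsT.
have -> : prob_subset R m E = mean [set: pairs n] m (fun S => `[< E S >]%:R).
  have msubT : msub [set: pairs n] m = [set S : {set pairs n} | #|S| == m].
    by apply/setP => S; rewrite !inE subsetT.
  rewrite /prob_subset /mean -card_msub msubT mulrC; congr (_ * _).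
  rewrite -natr_sum -sum1_card; congr (_%:R).
  rewrite [RHS]big_mkcond [LHS]big_mkcond; apply: eq_bigr => S _.
  by rewrite !inE; case: eqP => //= _; case: `[< E S >].
rewrite -{1}(@mean_const R _ [set: pairs n] m 1 mT) -meanB.
apply: mean_le => S _ cS; case: asboolP => [_|/(E_bad S cS) ->]; last by rewrite subrr.
by rewrite gerBl.
Qed.

(** Rounding up costs less than 1, so [2 * m < N + 2]. For odd [N] the sample may exceed its
    complement by one point. *)
Lemma ceil_half_bounds (R : realType) (N : nat) (f : R) :
  0 < f -> f <= 2^-1 ->
  let m := `|Num.ceil (N%:R * f)|%N in
  N%:R * f <= m%:R /\ (m.*2 <= N.+1)%N.
Proof.
move=> f0 f2 m; have Nf0 : 0 <= N%:R * f by rewrite mulr_ge0 // ltW.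
have mE : m%:R = (Num.ceil (N%:R * f))%:~R :> R.
  by rewrite -[LHS]/((m%:Z)%:~R) /m gez0_abs // ceil_ge0; lra.
split; first by rewrite mE ceil_ge.
have : m%:R < N%:R * f + 1 :> R.
  by rewrite mE; have := ceilB1_lt (N%:R * f); rewrite intrB; lra.
have Nf : N%:R * f <= N%:R / 2 by rewrite ler_wpM2l.
move=> m_lt; have : (m.*2)%:R < (N.+2)%:R :> R.
  by rewrite -muln2 natrM -addn2 natrD; lra.
by rewrite ltr_nat.
Qed.

(** [m <= 2 * p] yields the factor [sqrt 2], and [f * (1 - f) <= 1/4] makes the inverse square root
    at least 2, which absorbs the 2 of symmetrization. *)
Lemma rademacher_term_le (R : realType) (C lam f rho : R) (m p : nat) :
  0 < C -> 0 <= lam -> 0 < f -> f <= 2^-1 -> 0 < rho ->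
  (0 < p)%N -> (m <= p.*2)%N ->
  2 * (C * lam * Num.sqrt m%:R * Num.sqrt (p%:R * rho^-1 ^+ 2)) / p%:R <=
  C * lam * Num.sqrt 2 / (rho * Num.sqrt (f * (1 - f))).
Proof.
move=> C0 lam0 f0 f2 rho0 p_gt0 mp; have pR : 0 < p%:R :> R by rewrite ltr0n.
have sqrt_m : Num.sqrt m%:R <= Num.sqrt 2 * Num.sqrt p%:R :> R.
  by rewrite -sqrtrM // ler_wsqrtr // -natrM ler_nat mul2n.
have rhoV : 0 < rho^-1 by rewrite invr_gt0.
have Clam : 0 <= C * lam by rewrite mulr_ge0 // ltW.
have ff_gt0 : 0 < Num.sqrt (f * (1 - f)) by rewrite sqrtr_gt0 mulr_gt0 //; lra.
have ff_le : Num.sqrt (f * (1 - f)) <= 2^-1.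
  rewrite -[2^-1]ger0_norm ?invr_ge0 // -sqrtr_sqr ler_wsqrtr //.
  by have := sqr_ge0 (f - 2^-1); rewrite !expr2; lra.
have inv_ff : 2 <= (Num.sqrt (f * (1 - f)))^-1.
  by rewrite -[2]invrK lef_pV2 // posrE invr_gt0.
rewrite sqrtrM ?ler0n // sqrtr_sqr (ger0_norm (ltW rhoV)) invfM.
have sp : 0 < Num.sqrt p%:R :> R by rewrite sqrtr_gt0.
have p_eq : p%:R = Num.sqrt p%:R * Num.sqrt p%:R :> R by rewrite -expr2 sqr_sqrtr // ler0n.
rewrite [X in _ / X <= _]p_eq.
rewrite [leLHS](_ : _ = C * lam * rho^-1 * 2 * (Num.sqrt m%:R / Num.sqrt p%:R)); last first.
  by field; rewrite !gt_eqF.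
apply: (@le_trans _ _ (C * lam * rho^-1 * 2 * Num.sqrt 2)).
  apply: ler_wpM2l; last by rewrite ler_pdivrMr.
  by rewrite !mulr_ge0 // ltW.
rewrite (_ : C * lam * Num.sqrt 2 * _ = C * lam * rho^-1 * Num.sqrt 2 *
  (Num.sqrt (f * (1 - f)))^-1); last by ring.
rewrite -[leLHS]mulrA [2 * _]mulrC mulrA; apply: ler_wpM2l => //.
by rewrite !mulr_ge0 ?sqrtr_ge0 // ltW.
Qed.

(** Multiplying [1/m + 1/(N - m)] by [m] gives [N / (N - m)], at most 3 (attained at [N = 3],
    [m = 2]). Since [8 <= 3 ^+ 2], the square root contributes another 3, whence 9. *)
Lemma deviation_term_le (R : realType) (B f ell : R) (N m : nat) :
  0 <= B -> 0 < f -> f <= 2^-1 -> 0 <= ell ->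
  (0 < m < N)%N -> N%:R * f <= m%:R -> (m.*2 <= N.+1)%N ->
  B * (m%:R^-1 + (N - m)%:R^-1) * Num.sqrt (8 * m%:R * ell) <=
  9 * B / (1 - f) * Num.sqrt (ell / (N%:R * f)).
Proof.
move=> B0 f0 f2 ell0 /andP[m_gt0 mN] Nfm mN2.
have mR : 0 < m%:R :> R by rewrite ltr0n.
have NR : 0 < N%:R :> R by rewrite ltr0n (leq_ltn_trans _ mN).
have uR : 0 < (N - m)%:R :> R by rewrite ltr0n subn_gt0.
have u_ge1 : 1 <= (N - m)%:R :> R by rewrite ler1n subn_gt0.
have u_eq : (N - m)%:R = N%:R - m%:R :> R by rewrite natrB // ltnW.
have Nf0 : 0 < N%:R * f by rewrite mulr_gt0.
have -> : Num.sqrt (8 * m%:R * ell) = m%:R * Num.sqrt (8 * (ell / m%:R)).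
  have m_sqrt : m%:R = Num.sqrt (m%:R ^+ 2) :> R by rewrite sqrtr_sqr ger0_norm // ltW.
  rewrite {2}m_sqrt -sqrtrM ?sqr_ge0 //.
  by congr Num.sqrt; field; rewrite gt_eqF.
have s_le : Num.sqrt (8 * (ell / m%:R)) <= 3 * Num.sqrt (ell / (N%:R * f)).
  have -> : 3 = Num.sqrt (3 ^+ 2) :> R by rewrite sqrtr_sqr ger0_norm.
  rewrite -sqrtrM ?sqr_ge0 // ler_wsqrtr //.
  apply: (@le_trans _ _ (8 * (ell / (N%:R * f)))).
    rewrite ler_pM2l // ler_wpM2l // lef_pV2 ?posrE //.
  by rewrite ler_wpM2r ?divr_ge0 // ?ltW // expr2 -natrM ltr_nat.
rewrite (_ : B * _ * _ = B * (N%:R / (N - m)%:R) * Num.sqrt (8 * (ell / m%:R))); last first.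
  have -> : N%:R = (N - m)%:R + m%:R :> R by rewrite u_eq subrK.
  by field; rewrite !gt_eqF.
have f1 : 0 < 1 - f by lra.
have Nu : N%:R / (N - m)%:R <= 3 / (1 - f).
  apply: (@le_trans _ _ 3); last by rewrite ler_pdivlMr //; lra.
  by rewrite ler_pdivrMr // -natrM ler_nat; lia.
apply: (@le_trans _ _ (B * (3 / (1 - f)) * (3 * Num.sqrt (ell / (N%:R * f))))).
  apply: ler_pM => //; [|exact: sqrtr_ge0|exact: ler_wpM2l].
  by rewrite mulr_ge0 // divr_ge0 // ltW.
by rewrite le_eqVlt; apply/orP; left; apply/eqP; field; rewrite gt_eqF.
Qed.

Lemma leq_double_minn (m N : nat) :
  (m.*2 <= N.+1)%N -> (m < N)%N -> (m <= (minn m (N - m)).*2)%N.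
Proof. lia. Qed.

Theorem theorem3 (R : realType) :
  exists C1 : R, 0 < C1 /\
  forall (n d : nat) (e : rel 'I_n) (sigma : 'S_n) (U : 'M[R]_(d, n))
         (lam C f rho B : R) (l : R -> R -> R),
    simple_graph e ->
    in_Lab e U ->
    is_lambda1 (U^T *m U) lam ->
    0 < C -> 0 < f -> f <= 2^-1 ->
    0 < rho ->
    (forall y a, (y = 1 \/ y = -1) -> 0 <= l y a <= B) ->
    (forall y a a', (y = 1 \/ y = -1) ->
        `|l y a - l y a'| <= rho^-1 * `|a - a'|) ->
    let N : nat := #|{: pairs n}| in
    let m : nat := `|Num.ceil (N%:R * f)|%N in
    forall delta : R, 0 < delta ->
      1 - delta <=
      prob_subset R m (fun S : {set pairs n} =>
        forall w : 'M[R]_(d * d, 1),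
          is_prefrank_sol U sigma C S w ->
          er l (ylab R sigma) (scores U w) (~: S)
          <= er l (ylab R sigma) (scores U w) S
             + C * lam * Num.sqrt 2 / (rho * Num.sqrt (f * (1 - f)))
             + C1 * B / (1 - f) * Num.sqrt (ln (delta^-1) / (N%:R * f))).
Proof.
exists 9; split=> // n d e sigma U lam C f rho B l _ U_lab lamP C_gt0 f_gt0 f_le.
move=> rho_gt0 l_bound l_lip N m delta delta_gt0.
have [Nfm mN2] := ceil_half_bounds N f_gt0 f_le; rewrite -/m in Nfm mN2.
have lam0 : 0 <= lam by apply: le_trans (lambda1_ge1 U_lab lamP).
have lB k a : 0 <= l (ylab R sigma k) a <= B by apply/l_bound/ylab_sign.
have B0 : 0 <= B by case/andP: (l_bound 1 0 (or_introl erefl)); apply: le_trans.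
have mN : (m <= N)%N by lia.
have f1 : 0 < 1 - f by lra.
set E := (X in prob_subset _ _ X).
set R1 := C * lam * Num.sqrt 2 / (rho * Num.sqrt (f * (1 - f))) in E *.
set R2 := 9 * B / (1 - f) * Num.sqrt (ln (delta^-1) / (N%:R * f)) in E *.
have R1_ge0 : 0 <= R1.
  rewrite divr_ge0 // mulr_ge0 ?sqrtr_ge0 //; last exact: ltW.
  by rewrite mulr_ge0 // ltW.
have R2_ge0 : 0 <= R2.
  by rewrite mulr_ge0 ?sqrtr_ge0 // divr_ge0 ?mulr_ge0 // ltW.
have er_ge0 w (S : {set pairs n}) : 0 <= er l (ylab R sigma) (scores U w) S.
  by rewrite mulr_ge0 ?invr_ge0 // sumr_ge0 // => k _; case/andP: (lB k (scores U w k)).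
(* Covers the degenerate cases: if the error outside the sample is always 0, the inequality holds
   for every sample, its right side being nonnegative. *)
have deterministic : (forall S : {set pairs n}, #|S| = m ->
    forall w, er l (ylab R sigma) (scores U w) (~: S) = 0) ->
    1 - delta <= prob_subset R m E.
  move=> er0; apply: le_trans (@prob_subset_ge R n m E (fun=> false) mN _).
    by rewrite mean_const ?cardsT // subr0 gerBl ltW.
  move=> S cS; case=> w _; rewrite er0 //; apply: addr_ge0 => //; exact: addr_ge0.
(* Beyond this case the logarithm of [delta^-1] is nonnegative. *)
have [delta_ge1|delta_lt1] := lerP 1 delta.
  by apply: (@le_trans _ _ 0); [rewrite subr_le0 | rewrite divr_ge0].
(* The complement is empty, with error 0 because the inverse of 0 is 0. This includes [N = 0]. *)
have [Nm|lt_mN] := leqP N m.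
  apply: deterministic => S cS w; have -> : S = [set: pairs n].
    by apply/eqP; rewrite eqEcard subsetT cardsT cS.
  by rewrite setCT /er big_set0 mulr0.
(* The concentration bound needs a positive increment [c], and [c] is proportional to [B]. *)
have [B_eq0|B_neq0] := eqVneq B 0.
  apply: deterministic => S cS w; rewrite /er big1 ?mulr0 // => k _.
  by have := lB k (scores U w k); rewrite B_eq0 => /andP[l0 l0']; apply/le_anti/andP.
have B_gt0 : 0 < B by rewrite lt_def B_neq0.
have NR : 0 < N%:R :> R by rewrite ltr0n (leq_ltn_trans _ lt_mN).
have m_gt0 : (0 < m)%N.
  by rewrite -(ltr_nat R); apply: lt_le_trans Nfm; rewrite mulr_gt0.
have mR : 0 < m%:R :> R by rewrite ltr0n.
have uR : 0 < (N - m)%:R :> R by rewrite ltr0n subn_gt0.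
pose p := minn m (N - m).
have p_gt0 : (0 < p)%N by rewrite leq_min m_gt0 subn_gt0.
pose ell := ln delta^-1.
have ell0 : 0 <= ell by rewrite ln_ge0 // invf_ge1 // ltW.
pose viol (S : {set pairs n}) w := is_prefrank_sol U sigma C S w /\
  ~ er l (ylab R sigma) (scores U w) (~: S) <=
    er l (ylab R sigma) (scores U w) S + R1 + R2.
(* Choosing one violating solution per sample makes the class finite, so that
   no supremum over a ball is needed. *)
pose wS (S : {set pairs n}) := if pselect (#|S| = m /\ exists w, viol S w) is left H
  then projT1 (cid (proj2 H)) else 0.
(* The size condition in [wS] gives the whole class one radius; the default 0 satisfies it
   trivially. *)
have wS_norm S : \sum_c wS S c ord0 ^+ 2 <= (C * lam * Num.sqrt m%:R) ^+ 2.
  rewrite /wS; case: pselect => [[cS H]|_] /=.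
    case: cid => w [w_sol _] /=; rewrite -cS.
    exact: (prefrank_sol_norm_le U_lab lamP C_gt0 w_sol).
  by rewrite big1 ?sqr_ge0 // => c _; rewrite mxE expr0n.
(* The class is indexed by samples: [S] here names a fixed weight vector, independently of the
   sample on which it is evaluated. *)
pose L (k : pairs n) S := l (ylab R sigma k) (scores U (wS S) k).
pose V := C * lam * Num.sqrt m%:R * Num.sqrt (p%:R * rho^-1 ^+ 2).
have radV (a : 'I_p -> pairs n) :
    rad set0 (fun=> 0) [seq L (a i) | i <- enum 'I_p] <= V.
  (* Scaling the features by [rho^-1] turns the Lipschitz loss into a contraction of a linear class;
     unit features then give the sum [p * rho^-2] under the square root of [V]. *)
  have lip i S S' : `|L (a i) S - L (a i) S'| <=
      `|\sum_c wS S c ord0 * (rho^-1 * feature U (a i) c) -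
        \sum_c wS S' c ord0 * (rho^-1 * feature U (a i) c)|.
    have scale X : \sum_c wS X c ord0 * (rho^-1 * feature U (a i) c) =
        rho^-1 * scores U (wS X) (a i).
      by rewrite scores_feature mulr_sumr; apply: eq_bigr => c _; rewrite mulrCA.
    rewrite !scale -mulrBr normrM ger0_norm ?invr_ge0 ?(ltW rho_gt0) //.
    exact/l_lip/ylab_sign.
  apply: le_trans (rad_contraction set0 (enum 'I_p) (fun=> 0) lip) _.
  have Lam0 : 0 <= C * lam * Num.sqrt m%:R.
    by rewrite mulr_ge0 ?sqrtr_ge0 // mulr_ge0 // ltW.
  have := rad_linear set0 (enum 'I_p) (fun=> 0)
    (fun i c => rho^-1 * feature U (a i) c) Lam0 wS_norm.
  rewrite (_ : (fun S => \sum_c wS S c ord0 * 0) = fun=> 0); last first.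
    by apply/funext => S; rewrite big1 // => c _; rewrite mulr0.
  rewrite big1 => [|c _]; last by rewrite expr0n.
  rewrite add0r (eq_bigr (fun=> rho^-1 ^+ 2)) => [|i _]; last first.
    under eq_bigr => c _ do rewrite exprMn.
    by rewrite -mulr_sumr (feature_unit U_lab) mulr1.
  by rewrite big_const_seq count_predT size_enum_ord iter_addr_0 -[_ ^+ 2 *+ p]mulr_natl.
have gap_mean := mean_gap_le mN p_gt0 (geq_minl _ _) (geq_minr _ _) radV.
set mu := mean _ _ _ in gap_mean.
have mu_R1 : mu <= R1.
  apply: le_trans gap_mean _; apply: rademacher_term_le => //.
  exact: leq_double_minn.
pose c := B * (m%:R^-1 + (N - m)%:R^-1).
have c_gt0 : 0 < c by rewrite mulr_gt0 // addr_gt0 // invr_gt0.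
(* Chosen so that [t ^+ 2 / (8 * m%:R * c ^+ 2) = ell], which makes the tail exactly [delta]. *)
pose t := c * Num.sqrt (8 * m%:R * ell).
have t0 : 0 <= t by rewrite mulr_ge0 ?sqrtr_ge0 // ltW.
have t_R2 : t <= R2 by apply: deviation_term_le => //; rewrite m_gt0.
have gap_dist (S : {set pairs n}) x y : S \subset [set: pairs n] -> #|S| = m ->
    x \in [set: pairs n] -> y \in [set: pairs n] ->
    `|fmax set0 (gap L (tperm x y @: S)) - fmax set0 (gap L S)| <= c.
  move=> _ cS _ _; apply: fmax_dist => X.
  have := @gap_tperm_dist R _ _ L S x y X B (fun k => lB k (scores U (wS X) k)).
  by rewrite [#|~: S|]cardsCs setCK cS.
have mT : (m <= #|[set: pairs n]|)%N by rewrite cardsT.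
have conc := mean_concentration mT c_gt0 m_gt0 t0 gap_dist.
rewrite -/mu in conc.
apply: le_trans (@prob_subset_ge R n m E
  (fun S => mu + t < fmax set0 (gap L S)) mN _).
  rewrite lerD2l lerN2; apply: le_trans conc _.
  rewrite /t exprMn sqr_sqrtr; last by rewrite !mulr_ge0 // ltW.
  rewrite (_ : _ / _ = ell); last by field; rewrite !gt_eqF.
  by rewrite /ell lnV ?posrE // opprK lnK ?posrE.
move=> S cS nE; have viol_wS : viol S (wS S).
  rewrite /wS; case: pselect => [H|nH]; first by case: cid.
  exfalso; apply: nE => w w_sol; apply: contrapT => w_viol; apply: nH.
  by split=> //; exists w.
case: viol_wS => _ /negP; rewrite -ltNge => viol_wS.
(* Diagonal choice: on a failing sample [S], the class member indexed by [S] itself is a violator,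
   and its gap exceeds [R1 + R2], hence [mu + t]. *)
apply: lt_le_trans (fmax_ge set0 (gap L S) S).
have -> : gap L S S = er l (ylab R sigma) (scores U (wS S)) (~: S) -
                      er l (ylab R sigma) (scores U (wS S)) S by [].
rewrite ltrBrDr; apply: le_lt_trans viol_wS.
by rewrite addrC -[leRHS]addrA lerD2l lerD.
Qed.
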